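(* For all positive integers $n$, we have $\zeta(Q_n) \le \lceil \log_2 n \rceil + 2$, where $Q_n$ is the $n$-dimensional hypercube and $\zeta(Q_n)$ is its localization number.
   Context: The hypercube $Q_n$ is the graph whose vertices are the binary ordered $n$-tuples, two vertices being adjacent if and only if they differ in exactly one coordinate. Localization game: let $G$ be a finite, simple, undirected, connected graph and $m$ a positive integer. One player controls $m$ cops, the other controls an invisible robber. The robber first chooses a starting vertex $r_1$. In round $t=1,2,\dots$, the cops choose vertices $u_1,\dots,u_m$ of $G$ (arbitrarily; they are not restricted to moving to neighboring vertices, and the choice may depend on all earlier probes and their results) and learn the distance vector $(d_G(u_1,r_t),\dots,d_G(u_m,r_t))$; then the robber either stays or moves to a neighbor, so $r_{t+1}=r_t$ or $r_{t+1}$ is adjacent to $r_t$. The cops capture the robber in round $t$ if, after the probe of round $t$, the robber's current vertex $r_t$ is uniquely determined by the information the cops have received, i.e. all robber trajectories $r'_1,\dots,r'_t$ (consecutive vertices equal or adjacent) consistent with all the distance vectors received so far satisfy $r'_t=r_t$. The cops have a winning strategy if they have a strategy that captures the robber after finitely many rounds against every possible robber trajectory (equivalently, even a robber who knows the cops' entire strategy in advance). The robber wins if he is never captured. The localization number $\zeta(G)$ is the least positive integer $m$ for which $m$ cops have a winning strategy on $G$. *)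

(* Defs.v *)
From mathcomp Require Import all_boot.
From mathcomp Require Import boolp.

Set Implicit Arguments.
Unset Strict Implicit.
Unset Printing Implicit Defensive.

(** Finite, simple, undirected, connected graphs (with at least one vertex). *)

Record connected_graph := ConnectedGraph {
  vertex :> finType;
  adj : rel vertex;
  adj_sym : symmetric adj;
  adj_irr : irreflexive adj;
  adj_connect : forall x y, connect adj x y;
  vertex_gt0 : 0 < #|vertex|
}.

Section Distance.
Variable G : connected_graph.

Definition walk_of_length (x y : G) (k : nat) : bool :=
  [exists p : k.-tuple G, path (@adj G) x p && (last x p == y)].

Lemma ex_walk (x y : G) : exists k, walk_of_length x y k.
Proof.
have /connectP[p xp ->] := adj_connect x y.
by exists (size p); apply/existsP; exists (in_tuple p); rewrite xp /= eqxx.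
Qed.

Definition dist (x y : G) : nat := ex_minn (ex_walk x y).

Lemma dist_eq0 (x y : G) : (dist x y == 0) = (x == y).
Proof.
rewrite /dist; case: ex_minnP => k /existsP[p /andP[_ /eqP lp]] kmin.
apply/eqP/eqP => [k0 | exy].
  by move: p lp; rewrite k0 => p; rewrite (tuple0 p).
apply/eqP; rewrite -leqn0; apply: kmin.
by apply/existsP; exists [tuple]; rewrite /= exy eqxx.
Qed.

End Distance.

Section LocalizationGame.
Variables (G : connected_graph) (m : nat).

Definition probe := m.-tuple G.

Definition answer := m.-tuple nat.

Definition dist_vector (u : probe) (v : G) : answer :=
  [tuple dist (tnth u i) v | i < m].

Definition strategy := seq (probe * answer) -> probe.

(** Rounds are numbered from 0: [r t] is the position of the robber when the
    probe of the [t]-th round is made, and [history s r t] lists the probes and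
    answers of the [t] rounds before it. *)

Fixpoint history (s : strategy) (r : nat -> G) (t : nat) :
    seq (probe * answer) :=
  if t is t'.+1 then
    let h := history s r t' in rcons h (s h, dist_vector (s h) (r t'))
  else [::].

Definition probe_at (s : strategy) (r : nat -> G) (t : nat) : probe :=
  s (history s r t).

Definition robber_move (x y : G) : bool := (y == x) || adj x y.

(** Only the values [r 0, ..., r t] are constrained. *)
Definition trajectory_upto (t : nat) (r : nat -> G) : Prop :=
  forall i, i < t -> robber_move (r i) (r i.+1).

Definition consistent (s : strategy) (r r' : nat -> G) (t : nat) : Prop :=
  forall i, i <= t ->
    dist_vector (probe_at s r i) (r' i) = dist_vector (probe_at s r i) (r i).

Definition captured_at (s : strategy) (r : nat -> G) (t : nat) : Prop :=
  forall r' : nat -> G,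
    trajectory_upto t r' -> consistent s r r' t -> r' t = r t.

Definition winning (s : strategy) : Prop :=
  forall r : nat -> G, (forall i, robber_move (r i) (r i.+1)) ->
    exists t, captured_at s r t.

Definition cops_win : Prop := exists s : strategy, winning s.

End LocalizationGame.

(** Probing every vertex captures the robber at once, so the localization
    number is well defined. *)
Lemma ex_cops_win (G : connected_graph) :
  exists m, (0 < m) && `[< cops_win G m >].
Proof.
exists #|G|; rewrite vertex_gt0; apply/asboolP.
exists (fun=> [tuple enum_val i | i < #|G|]) => r _; exists 0 => r' _.
move=> /(_ 0 (leqnn 0))/(congr1 (fun a => tnth a (enum_rank (r 0)))).
rewrite !tnth_mktuple enum_rankK => h; apply/esym/eqP.
by rewrite -dist_eq0 h dist_eq0.
Qed.

Definition localization_number (G : connected_graph) : nat :=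
  ex_minn (ex_cops_win G).

Section Hypercube.
Variable n : nat.

Definition cube_adj : rel (n.-tuple bool) :=
  fun x y => #|[set i | tnth x i != tnth y i]| == 1.

Lemma cube_adj_sym : symmetric cube_adj.
Proof.
by move=> x y; congr (#|pred_of_set _| == 1); apply/setP => i; rewrite !inE eq_sym.
Qed.

Lemma cube_adj_irr : irreflexive cube_adj.
Proof.
move=> x; rewrite /cube_adj (_ : [set _ | _] = set0) ?cards0 //.
by apply/setP => i; rewrite !inE eqxx.
Qed.

Lemma cube_adj_connect x y : connect cube_adj x y.
Proof.
have [k] := ubnP #|[set i | tnth x i != tnth y i]|.
elim: k x => // k IH x; rewrite ltnS => xyk.
have [D0 | [i]] := set_0Vmem [set i | tnth x i != tnth y i].
  suff -> : x = y by exact: connect0.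
  apply: eq_from_tnth => i; apply/eqP; apply/negPn/negP => xyi.
  by have := in_set0 i; rewrite -D0 inE xyi.
move=> iD; pose z := [tuple if j == i then tnth y i else tnth x j | j < n].
apply: (@connect_trans _ _ z); last first.
  apply: IH; apply: leq_trans xyk; apply: proper_card.
  apply/properP; split; last by exists i => //; rewrite inE tnth_mktuple !eqxx.
  apply/subsetP => j; rewrite !inE tnth_mktuple.
  by case: (j =P i) => // ->; rewrite eqxx.
apply: connect1; rewrite /cube_adj (_ : [set _ | _] = [set i]) ?cards1 //.
apply/setP => j; rewrite !inE tnth_mktuple.
by case: (j =P i) => [-> | _]; [rewrite inE in iD | rewrite eqxx].
Qed.

Lemma cube_gt0 : 0 < #|{: n.-tuple bool}|.
Proof. by apply/card_gt0P; exists (nseq_tuple n false). Qed.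

Definition hypercube : connected_graph :=
  ConnectedGraph cube_adj_sym cube_adj_irr cube_adj_connect cube_gt0.

End Hypercube.

(* Main.v *)
Require Import Defs.
From mathcomp Require Import all_boot.
From mathcomp Require Import boolp.

(** Identify a vertex [x] of the hypercube with the set [ones x] of its
    coordinates equal to 1. A probe of the zero vertex returns the size of
    [ones x], and then a probe of the indicator vector of [A] amounts to
    learning [#|A :&: ones x|], since the symmetric difference of [A] and
    [ones x] has size [#|A| + #|ones x| - 2 * #|A :&: ones x|]
    ([dist_indicator]). So one cop on the zero vertex makes every other cop a
    counter of ones inside a set of coordinates of its choice.

    The cops learn the coordinates one by one: after round [t] (counted from 0)
    they know the coordinates [0, ..., t] of the robber. In round [t], a second
    cop reads coordinate [t] directly, through the set [{t}]. The remaining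
    [up_log 2 n] cops keep the known coordinates up to date. The robber has
    changed at most one coordinate; give a change of [j < t] the code [j.+1],
    and the absence of a change among the known coordinates the code 0. The cop
    number [q] counts ones in the set of the [j < t] whose code has binary digit
    1 in place [q]; as the old count is known, the new one tells whether the
    changed coordinate lies in that set ([move_count_eq]), that is, it reveals
    the digit [q] of the code. All codes are at most [t < n <= 2 ^ up_log 2 n],
    so these digits determine the code ([digits_inj]) and hence the move
    ([known_step]). After round [n.-1] all coordinates are known. The probes
    depend on the number of the round only. *)

Set Implicit Arguments.
Unset Strict Implicit.
Unset Printing Implicit Defensive.

Definition digit (q m : nat) : bool := odd (m %/ 2 ^ q).

Lemma digits_inj L a b :
  a < 2 ^ L -> b < 2 ^ L -> (forall q, q < L -> digit q a = digit q b) -> a = b.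
Proof.
elim: L a b => [|L IH] a b; first by case: a; case: b.
rewrite expnS mul2n -!ltn_half_double => aL bL ab.
rewrite -(odd_double_half a) -(odd_double_half b); congr (_ + _.*2).
  by have := ab 0 (ltn0Sn L); rewrite /digit !divn1 => ->.
apply: IH => // q qL; have := ab q.+1 qL.
by rewrite /digit expnS !divnMA !divn2.
Qed.

Section Cube.
Variable n : nat.
Implicit Types (x y u : n.-tuple bool) (A : {set 'I_n}).

Definition diff x y : {set 'I_n} := [set i | tnth x i != tnth y i].
Definition ones x : {set 'I_n} := [set i | tnth x i].
Definition indicator A : n.-tuple bool := [tuple i \in A | i < n].

Lemma card_diff_triangle x y u : #|diff x u| <= #|diff x y| + #|diff y u|.
Proof.
apply: leq_trans (leq_card_setU _ _); apply/subset_leq_card/subsetP => i.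
by rewrite !inE; case: (tnth x i); case: (tnth y i); case: (tnth u i).
Qed.

Lemma card_diff_path x p : path (@cube_adj n) x p -> #|diff x (last x p)| <= size p.
Proof.
elim: p x => [|y p IH] x /=; first by rewrite leqn0 cards_eq0; move=> _;
  apply/eqP/setP => i; rewrite !inE eqxx.
move=> /andP[/eqP xy yp]; apply: leq_trans (card_diff_triangle x y _) _.
by rewrite [#|diff x y|]xy add1n ltnS IH.
Qed.

Lemma exists_path_diff x y :
  exists p, [/\ path (@cube_adj n) x p, last x p = y & size p = #|diff x y|].
Proof.
have [k Dk] : {k | #|diff x y| = k} by exists #|diff x y|.
rewrite Dk; elim: k x Dk => [|k IH] x Dk.
  exists [::]; split=> //=; apply: eq_from_tnth => i; apply/eqP/negPn/negP => xyi.
  by move/eqP: Dk; rewrite cards_eq0 => /eqP/setP/(_ i); rewrite !inE xyi.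
have /card_gt0P[i iD] : 0 < #|diff x y| by rewrite Dk.
pose z := [tuple if j == i then tnth y i else tnth x j | j < n].
have Dz : diff z y = diff x y :\ i.
  by apply/setP => j; rewrite !inE tnth_mktuple; case: (eqVneq j i) => [->|]; rewrite ?eqxx.
have [|p [zp lp sp]] := IH z.
  by apply: succn_inj; rewrite Dz -Dk [RHS](cardsD1 i) iD.
exists (z :: p); split=> //=; last by rewrite sp.
rewrite zp andbT /cube_adj (_ : [set _ | _] = [set i]) ?cards1 //.
apply/setP => j; rewrite !inE tnth_mktuple.
by case: (j =P i) => [-> | _]; [rewrite inE in iD | rewrite eqxx].
Qed.

Lemma dist_hypercube x y : dist (x : hypercube n) y = #|diff x y|.
Proof.
rewrite /dist; case: ex_minnP => k /existsP[p /andP[xp /eqP lp]] kmin.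
apply/eqP; rewrite eqn_leq; apply/andP; split.
  have [q [xq lq <-]] := exists_path_diff x y.
  by apply: kmin; apply/existsP; exists (in_tuple q); rewrite /= xq lq eqxx.
by have := card_diff_path xp; rewrite lp size_tuple.
Qed.

Lemma dist_indicator A x :
  dist (indicator A : hypercube n) x + (#|A :&: ones x|).*2 = #|A| + #|ones x|.
Proof.
rewrite dist_hypercube -(cardsID (ones x) A) -(cardsID A (ones x)).
rewrite (setIC (ones x)) -addnn [RHS]addnACA [RHS]addnC; congr (_ + _).
rewrite -cardsUI (_ : (A :\: ones x) :&: (ones x :\: A) = set0); last first.
  by apply/setP => i; rewrite !inE; case: (i \in A); case: (tnth x i).
rewrite cards0 addn0; apply: eq_card => i.
by rewrite !inE tnth_mktuple; case: (i \in A); case: (tnth x i).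
Qed.

(** Comparing with the answer of the zero vertex turns equal distances into
    equal counts. *)
Lemma count_of_dist A x y :
    dist (indicator set0 : hypercube n) x = dist (indicator set0 : hypercube n) y ->
    dist (indicator A : hypercube n) x = dist (indicator A : hypercube n) y ->
  #|A :&: ones x| = #|A :&: ones y|.
Proof.
have := dist_indicator A y; have := dist_indicator A x.
have := dist_indicator set0 y; have := dist_indicator set0 x.
rewrite !set0I !cards0 !addn0 !add0n => -> -> hx hy exy dxy.
by apply: double_inj; apply/eqP; rewrite -(eqn_add2l (dist (indicator A : hypercube n) x));
  rewrite hx dxy hy exy.
Qed.

Lemma move_inj x y i j :
  robber_move (x : hypercube n) y ->
  tnth x i != tnth y i -> tnth x j != tnth y j -> i = j.
Proof.
case/orP=> [/eqP->|]; first by rewrite eqxx.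
by move=> /eqP xy xi xj; apply: (card_le1_eqP (eq_leq xy)); rewrite inE.
Qed.

(** A move changes at most one coordinate, so changes inside [A] cannot cancel
    in the count. *)
Lemma move_count_eq A x y :
    robber_move (x : hypercube n) y ->
  (#|A :&: ones x| == #|A :&: ones y|) = [forall i in A, tnth x i == tnth y i].
Proof.
move=> xy; apply/eqP/forall_inP => [cxy i iA | eqA]; last first.
  by apply: eq_card => i; rewrite !inE; case iA: (i \in A) => //=; rewrite (eqP (eqA i iA)).
apply/negPn/negP => xyi; move: cxy.
rewrite (cardsD1 i (A :&: _)) [RHS](cardsD1 i) !inE iA /=.
rewrite (_ : (A :&: ones x) :\ i = (A :&: ones y) :\ i).
  by move/addIn; case: (tnth x i) xyi; case: (tnth y i).
apply/setP => j; rewrite !inE; case: (eqVneq j i) => //= ji.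
by case: (eqVneq (tnth x j) (tnth y j)) => [->//|xyj]; rewrite (move_inj xy xyj xyi) eqxx in ji.
Qed.

(** The code of coordinate [j] is [j.+1] rather than [j], so that a change of
    coordinate 0 differs from the absence of a change. *)
Definition digit_set (t q : nat) : {set 'I_n} := [set j : 'I_n | (j < t) && digit q j.+1].

(** The heart of the strategy: [x] and [y] are two candidates for the position
    of the robber, with the same known coordinates. If their moves led to
    different values at [i], then only one of them, say that of [x], would
    change [i]. Then either the move of [y] changes some known coordinate [k],
    and a digit distinguishes the codes of [i] and [k], or it changes none, and
    a digit distinguishes the code of [i] from 0. *)
Lemma known_step t x y x' y' :
    t <= n.-1 ->
    robber_move (x : hypercube n) x' -> robber_move (y : hypercube n) y' ->
    (forall i : 'I_n, i < t -> tnth x i = tnth y i) ->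
    (forall q, q < up_log 2 n ->
       #|digit_set t q :&: ones x'| = #|digit_set t q :&: ones y'|) ->
  forall i : 'I_n, i < t -> tnth x' i = tnth y' i.
Proof.
move=> tn xx' yy' xy cnt i it; apply/eqP/negPn/negP => xyi'.
wlog xi : x y x' y' xx' yy' xy cnt xyi' / tnth x i != tnth x' i.
  move=> W; case: (eqVneq (tnth x i) (tnth x' i)) => [xi|xi]; last exact: (W x y x' y').
  apply: (W y x y' x') => //; first by move=> j jt; rewrite xy.
  - by move=> q qL; rewrite cnt.
  - by rewrite eq_sym.
  by rewrite -xy // xi.
have yi : tnth y i = tnth y' i.
  by move: xi xyi'; rewrite (xy i it);
    case: (tnth x' i); case: (tnth y i); case: (tnth y' i).
have same q : q < up_log 2 n -> [forall j in digit_set t q, tnth x j == tnth x' j]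
                              = [forall j in digit_set t q, tnth y j == tnth y' j].
  move=> qL; rewrite -!move_count_eq // cnt //; congr (_ == _).
  apply: eq_card => j; rewrite !inE; case jt: (j < t) => //=.
  by rewrite xy.
have code (j : 'I_n) : j < t -> j.+1 < 2 ^ up_log 2 n.
  move=> jt; apply: leq_trans (up_logP n (isT : 1 < 2)).
  by apply: leq_ltn_trans jt _; rewrite (leq_ltn_trans tn) // prednK // (leq_ltn_trans _ (ltn_ord i)).
(* A move that changes the known coordinate [j] changes nothing else, so
   whether it shows in the count [q] is the digit [q] of the code of [j]. *)
have sameE (w w' : n.-tuple bool) (j : 'I_n) q :
    robber_move (w : hypercube n) w' -> j < t -> tnth w j != tnth w' j ->
    [forall j in digit_set t q, tnth w j == tnth w' j] = ~~ digit q j.+1.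
  move=> ww' jt wj; apply/forall_inP/idP => [h|dj k].
    by apply/negP => dj; move: wj; rewrite h // inE jt.
  rewrite inE => /andP[kt dk]; apply/negPn/negP => wk.
  by rewrite (move_inj ww' wj wk) dk in dj.
case: (pickP [pred k : 'I_n | (k < t) && (tnth y k != tnth y' k)]) => [k|none] /=.
  move=> /andP[kt yk].
  suff /succn_inj/val_inj ik : i.+1 = k.+1 by rewrite -ik yi eqxx in yk.
  apply: digits_inj (code i it) (code k kt) _ => q qL.
  by apply: negb_inj; rewrite -(sameE x x') // -(sameE y y') // same.
suff : i.+1 = 0 by [].
apply: digits_inj (code i it) _ _ => [|q qL]; first by rewrite expn_gt0.
apply: negb_inj; rewrite -(sameE x x') // same // /digit div0n /=.
apply/forall_inP => k; rewrite inE => /andP[kt _].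
by have := none k; rewrite /= kt => /negbFE.
Qed.

Definition probe_set (t c : nat) : {set 'I_n} :=
  match c with
  | 0 => set0
  | 1 => [set j : 'I_n | j == t :> nat]
  | q.+2 => digit_set t q
  end.

Definition cube_strategy : strategy (hypercube n) (up_log 2 n + 2) :=
  fun h => [tuple indicator (probe_set (size h) c) | c < up_log 2 n + 2].

Lemma size_history (G : connected_graph) m (s : strategy G m) r t :
  size (history s r t) = t.
Proof. by elim: t => //= t IH; rewrite size_rcons IH. Qed.

Lemma consistent_count r r' t k c :
    consistent cube_strategy r r' t -> k <= t -> c < up_log 2 n + 2 ->
  #|probe_set k c :&: ones (r' k)| = #|probe_set k c :&: ones (r k)|.
Proof.
move=> con kt cL.
have answ d : d < up_log 2 n + 2 ->
    dist (indicator (probe_set k d) : hypercube n) (r' k)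
    = dist (indicator (probe_set k d) : hypercube n) (r k).
  move=> dL; have := congr1 (fun a => tnth a (Ordinal dL)) (con k kt).
  by rewrite !tnth_mktuple size_history.
by apply: count_of_dist; [apply: (answ 0); rewrite addn2 | apply: answ].
Qed.

Lemma cube_strategy_known r r' t :
    t < n -> (forall i, robber_move (r i) (r i.+1)) ->
    trajectory_upto t r' -> consistent cube_strategy r r' t ->
  forall i : 'I_n, i < t.+1 -> tnth (r' t) i = tnth (r t) i.
Proof.
move=> tn rP r'P con.
have cur k (i : 'I_n) : k <= t -> i = k :> nat -> tnth (r' k) i = tnth (r k) i.
  move=> kt ik; have ones1 x : #|probe_set k 1 :&: ones x| = tnth x i.
    case xi: (tnth x i); [apply/eqP/cards1P; exists i | apply/eqP; rewrite cards_eq0; apply/eqP];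
      apply/setP => j; rewrite !inE -ik (inj_eq val_inj);
      by case: eqP => [->|].
  have := consistent_count (c := 1) con kt; rewrite addn2 => /(_ isT).
  by rewrite !ones1; case: (tnth _ i); case: (tnth _ i).
suff known k : k <= t -> forall i : 'I_n, i < k.+1 -> tnth (r' k) i = tnth (r k) i.
  exact: known.
elim: k => [|k IH] kt i; rewrite ltnS leq_eqVlt => /orP[/eqP ik|ik]; try exact: cur ik.
  by [].
have kn : k.+1 <= n.-1 by rewrite -ltnS (ltn_predK tn) (leq_ltn_trans kt).
apply: (known_step kn (r'P k kt) (rP k) (IH (ltnW kt)) _ ik) => q qL.
by apply: (consistent_count (c := q.+2) con kt); rewrite addn2.
Qed.

End Cube.

Theorem theorem4p1 (n : nat) (n_gt0 : 0 < n) :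
  localization_number (hypercube n) <= up_log 2 n + 2.
Proof.
rewrite /localization_number; case: ex_minnP => m _; apply.
rewrite addn2 /= -addn2; apply/asboolP; exists (@cube_strategy n) => r rP.
exists n.-1 => r' r'P con; apply: eq_from_tnth => i.
by apply: (cube_strategy_known _ rP r'P con); rewrite prednK.
Qed.
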